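(* Suppose that $\Xi=\{\xi_q\}\times\mathbb{R}^{m_2}$ for a fixed $\xi_q\in\mathbb{R}^{m_1}$ and $p=1$. Then for every $x\in\mathcal X$, $$\mathcal Z(x)=\frac1N\sum_{j\in[N]}\max_{r\in\{-1,1\}}\max_{i\in[m_2]}\min_{y\in\mathbb{R}^{n_2}}\left\{(Q\xi_q+q)^\top y:\ T(x)\zeta_T^j+Wy-\theta r\,T(x)e_i\ge h(x)\right\},$$ where $e_i$ is the $i$th standard basis vector of $\mathbb{R}^{m_2}$.
   Context: Setting. $[k]=\{1,\dots,k\}$. Let $n_1,n_2,m_1,m_2,\ell,N$ be positive integers, $\mathcal X\subseteq\mathbb{R}^{n_1}$, $c\in\mathbb{R}^{n_1}$, $W\in\mathbb{R}^{\ell\times n_2}$, $Q\in\mathbb{R}^{n_2\times m_1}$, $q\in\mathbb{R}^{n_2}$ fixed, and let $h:\mathbb{R}^{n_1}\to\mathbb{R}^{\ell}$ and $T:\mathbb{R}^{n_1}\to\mathbb{R}^{\ell\times m_2}$ be affine. The support is $\Xi=\Xi_q\times\Xi_T$ with $\Xi_q\subseteq\mathbb{R}^{m_1}$, $\Xi_T\subseteq\mathbb{R}^{m_2}$. For $\xi=(\xi_q,\xi_T)\in\Xi$ the recourse function is $$Z(x,\xi)=\min_{y\in\mathbb{R}^{n_2}}\{(Q\xi_q+q)^\top y:\ T(x)\xi_T+Wy\ge h(x)\}.$$ Minima are read as infima, equal to $+\infty$ if infeasible. Ambiguity set. Given $p\in[1,\infty]$, $\theta\ge0$ and points $\zeta^j=(\zeta_q^j,\zeta_T^j)\in\Xi$,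 $j\in[N]$, let $\mathbb{P}_{\tilde\zeta}$ be the empirical distribution putting mass $1/N$ on each $\zeta^j$. Let $W^\infty(\mathbb{P}_1,\mathbb{P}_2)$ be the infimum, over all joint distributions $\mathbb{Q}$ of $(\tilde\xi_1,\tilde\xi_2)$ with marginals $\mathbb{P}_1,\mathbb{P}_2$, of the $\mathbb{Q}$-essential supremum of $\|\tilde\xi_1-\tilde\xi_2\|_p$, where $\|\cdot\|_p$ is the $\ell_p$ norm on $\mathbb{R}^{m_1+m_2}$. Let $\mathcal P=\{\mathbb{P}:\mathbb{P}(\tilde\xi\in\Xi)=1,\ W^\infty(\mathbb{P},\mathbb{P}_{\tilde\zeta})\le\theta\}$ and $\mathcal Z(x)=\sup_{\mathbb{P}\in\mathcal P}\mathbb{E}_{\mathbb{P}}[Z(x,\tilde\xi)]$. Standing assumption (sufficiently expensive recourse). For all $x\in\mathcal X$ and $\xi\in\Xi$ the dual of the recourse problem is feasible, i.e. there is $\pi\in\mathbb{R}_+^\ell$ with $W^\top\pi=Q\xi_q+q$. *)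

(* Defs.v *)
From HB Require Import structures.
From mathcomp Require Import all_boot all_order all_algebra.
From mathcomp Require Import all_classical all_reals all_analysis.
From mathcomp Require Import ess_sup_inf.

Set Implicit Arguments.
Unset Strict Implicit.
Unset Printing Implicit Defensive.

Import Order.TTheory GRing.Theory Num.Theory.
Import numFieldNormedType.Exports.

Local Open Scope classical_set_scope.
Local Open Scope ring_scope.

Definition affine_map (R : realType) (U V : lmodType R) (f : U -> V) : Prop :=
  exists (g : {linear U -> V}) (b : V), forall x, f x = g x + b.

Definition cv_ge (R : realType) (n : nat) (u v : 'cV[R]_n) : Prop :=
  forall i, v i 0 <= u i 0.

(* For 1 <= p <= +oo; the value at p = -oo is a dummy. *)
Definition lp_norm (R : realType) (n : nat) (p : \bar R) (v : 'cV[R]_n) : R :=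
  match p with
  | r%:E => (\sum_(i < n) `|v i 0| `^ r) `^ r^-1
  | +oo%E => \big[Num.max/0]_(i < n) `|v i 0|
  | -oo%E => 0
  end.

(* R^m1 x R^m2 with its Borel sigma-algebra. *)
Notation uncertainty R m1 m2 :=
  (g_sigma_algebraType (@open ('cV[R]_m1 * 'cV[R]_m2)%type)).

Definition lp_dist (R : realType) (m1 m2 : nat) (p : \bar R)
    (xi1 xi2 : uncertainty R m1 m2) : R :=
  lp_norm p (col_mx (xi1.1 - xi2.1) (xi1.2 - xi2.2)).

Definition coupling (d : measure_display) (T : measurableType d) (R : realType)
    (P1 P2 : set T -> \bar R) : set (probability (T * T)%type R) :=
  [set Q | forall A, measurable A ->
     pushforward Q fst A = P1 A /\ pushforward Q snd A = P2 A].

Definition wasserstein_oo (d : measure_display) (T : measurableType d)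
    (R : realType) (dist : T -> T -> R) (P1 P2 : set T -> \bar R) : \bar R :=
  ereal_inf [set ess_sup Q (fun z => (dist z.1 z.2)%:E) | Q in coupling P1 P2].

Definition empirical (d : measure_display) (T : measurableType d)
    (R : realType) (N : nat) (zeta : 'I_N -> T) (A : set T) : \bar R :=
  ((N%:R^-1)%:E * \sum_(j < N) \d_(zeta j) A)%E.

Definition ambiguity_set (R : realType) (m1 m2 N : nat) (p : \bar R) (theta : R)
    (Xi : set (uncertainty R m1 m2)) (zeta : 'I_N -> uncertainty R m1 m2) :
    set (probability (uncertainty R m1 m2) R) :=
  [set P | P Xi = 1%E /\
     (wasserstein_oo (@lp_dist R m1 m2 p) P (empirical R zeta) <= theta%:E)%E].

(* Infimum of b^T y over y in F; it is +oo when F is empty. *)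
Definition lin_min (R : realType) (n : nat) (b : 'cV[R]_n) (F : set 'cV[R]_n) :
    \bar R :=
  ereal_inf [set ((b^T *m y) 0 0)%:E | y in F].

Definition recourse (R : realType) (n1 n2 m1 m2 l : nat)
    (W : 'M[R]_(l, n2)) (Q : 'M[R]_(n2, m1)) (q : 'cV[R]_n2)
    (h : 'cV[R]_n1 -> 'cV[R]_l) (T : 'cV[R]_n1 -> 'M[R]_(l, m2))
    (x : 'cV[R]_n1) (xi : uncertainty R m1 m2) : \bar R :=
  lin_min (Q *m xi.1 + q) [set y | cv_ge (T x *m xi.2 + W *m y) (h x)].

(* The recourse problem is only given for xi in Xi, and P Xi = 1 for every P
   of the ambiguity set, so the expectation is taken over Xi. *)
Definition worst_case (R : realType) (n1 n2 m1 m2 l N : nat)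
    (W : 'M[R]_(l, n2)) (Q : 'M[R]_(n2, m1)) (q : 'cV[R]_n2)
    (h : 'cV[R]_n1 -> 'cV[R]_l) (T : 'cV[R]_n1 -> 'M[R]_(l, m2))
    (p : \bar R) (theta : R)
    (Xi : set (uncertainty R m1 m2)) (zeta : 'I_N -> uncertainty R m1 m2)
    (x : 'cV[R]_n1) : \bar R :=
  ereal_sup [set (\int[P]_(xi in Xi) recourse W Q q h T x xi)%E
            | P in ambiguity_set p theta Xi zeta].

Definition sufficiently_expensive (R : realType) (n1 n2 m1 m2 l : nat)
    (W : 'M[R]_(l, n2)) (Q : 'M[R]_(n2, m1)) (q : 'cV[R]_n2)
    (X : set 'cV[R]_n1) (Xi : set (uncertainty R m1 m2)) : Prop :=
  forall x xi, X x -> Xi xi ->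
    exists pi : 'cV[R]_l, cv_ge pi 0 /\ W^T *m pi = Q *m xi.1 + q.

(* Main.v *)
(* Moving a data point in the l1 ball of radius theta cannot increase the
   recourse value beyond its maximum over the vertices of the ball, because the
   recourse value is convex in xi_T; moving the mass of each data point to a
   best vertex gives the lower bound.

   For the upper bound the infimum defining the Wasserstein distance need not
   be attained a priori, so one only has couplings of radius theta + e, while
   the recourse value may jump to +oo beyond radius theta.  Let v_j be the
   maximal recourse value over the ball around zeta_j.  On the ball-covered
   part of the space the recourse value is at most the minimum of the v_j over
   the balls containing the point; the couplings show that the expectation of
   this bounded function is at most the average of the v_j, up to a multiple of
   the probability that the point is at distance in ]theta, theta + e] of some
   zeta_j, and this probability tends to 0 with e. *)
Require Import Defs.
From HB Require Import structures.
From mathcomp Require Import all_boot all_order all_algebra.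
From mathcomp Require Import all_classical all_reals all_analysis.
From mathcomp Require Import measurable_realfun ess_sup_inf ring.

Import Order.TTheory GRing.Theory Num.Theory.
Import numFieldNormedType.Exports.

Local Open Scope classical_set_scope.
Local Open Scope ring_scope.

Set Implicit Arguments.
Unset Strict Implicit.
Unset Printing Implicit Defensive.

(** * Comparison and change of variables for integrals *)

Section integral_facts.
Context d (T : measurableType d) (R : realType).
Local Open Scope ereal_scope.

(* No measurability is needed: the integral is a difference of suprema over
   simple functions. *)
Lemma le_integral_nonmeasurable (mu : {measure set T -> \bar R})
    (f g : T -> \bar R) :
  (forall x, f x <= g x) -> \int[mu]_x f x <= \int[mu]_x g x.
Proof.
move=> fg; rewrite /integral !patch_setT; apply: leeB.
  apply: le_ereal_sup => _ [h /= hf <-]; exists h => //= x.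
  apply: le_trans (hf x) _; rewrite !funeposE.
  by rewrite ge_max le_max fg /= le_max lexx orbT.
apply: le_ereal_sup => _ [h /= hf <-]; exists h => //= x.
apply: le_trans (hf x) _; rewrite !funenegE.
by rewrite ge_max le_max leeN2 fg /= le_max lexx orbT.
Qed.

(** Moves integrals from a marginal to a coupling, whose marginals are known only through their
    values on measurable sets. *)
Lemma ge0_integral_same_law d' (T' : measurableType d')
    (mu : {measure set T -> \bar R}) (nu : {measure set T' -> \bar R})
    (phi : T -> T') (f : T' -> \bar R) :
  measurable_fun [set: T] phi ->
  (forall A, measurable A -> pushforward mu phi A = nu A) ->
  measurable_fun [set: T'] f -> (forall y, 0 <= f y) ->
  \int[nu]_y f y = \int[mu]_x f (phi x).
Proof.
move=> mphi munu mf f0.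
pose phi_mixin := isMeasurableFun.Build _ _ _ _ _ mphi.
pose phi' : {mfun _ >-> _} := HB.pack phi phi_mixin.
transitivity (\int[pushforward mu phi']_y f y).
  by apply: eq_measure_integral => A mA _; rewrite [RHS]munu.
by rewrite ge0_integral_pushforward.
Qed.

End integral_facts.

(** * Uniform distributions on finitely many points *)

Section uniform_measure.
Context d (T : measurableType d) (R : realType) (n : nat).
Variable z : 'I_n.+1 -> T.
Local Open Scope ereal_scope.

(** The empirical distribution rebuilt from [mscale] and [msum], so that its measure structure is
    inferred. As [msum] runs over naturals, points are reached through [inord], which needs a
    successor index. *)
Definition uniform_at : set T -> \bar R :=
  mscale ((n.+1%:R^-1)%:nng)%R (msum (fun k => \d_(z (inord k))) n.+1).

HB.instance Definition _ := Measure.on uniform_at.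

Lemma uniform_atE A : uniform_at A = empirical R z A.
Proof.
rewrite /uniform_at /mscale /empirical /msum /=; congr (_ * _).
by apply: eq_bigr => j _; rewrite inord_val.
Qed.

Let uniform_at_setT : uniform_at setT = 1.
Proof.
rewrite uniform_atE /empirical.
under eq_bigr do rewrite diracT.
rewrite sumEFin sumr_const card_ord -EFinM.
by rewrite mulVf// pnatr_eq0.
Qed.

HB.instance Definition _ :=
  Measure_isProbability.Build _ _ _ uniform_at uniform_at_setT.

Lemma ge0_integral_uniform_at (f : T -> \bar R) :
  measurable_fun [set: T] f -> (forall x, 0 <= f x) ->
  \int[uniform_at]_x f x = (n.+1%:R^-1)%:E * \sum_(j < n.+1) f (z j).
Proof.
move=> mf f0; rewrite ge0_integral_mscale// ge0_integral_measure_sum//.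
congr (_ * _); apply: eq_bigr => j _.
by rewrite integral_dirac// diracT mul1e inord_val.
Qed.

(* Only the values of [f] on the support matter, so that [f] may be
   non-measurable: it is compared with its extension by -oo. *)
Lemma integral_uniform_at_ge (f : T -> \bar R) :
  (forall a : T, measurable [set a]) -> (forall j, f (z j) != -oo) ->
  (n.+1%:R^-1)%:E * \sum_(j < n.+1) f (z j) <= \int[uniform_at]_x f x.
Proof.
move=> m1 fz.
pose F x := if x \in range z then f x else -oo.
have Fz j : F (z j) = f (z j) by rewrite /F ifT// inE; exists j.
have mrange : measurable (range z).
  rewrite (_ : range z = \bigcup_j [set z j]); last first.
    by apply/seteqP; split => [_ [j _ <-]|x [j _ ->]]; exists j.
  by apply: fin_bigcup_measurable.
have mF : measurable_fun [set: T] F.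
  move=> _ Y mY; rewrite setTI.
  rewrite (_ : _ @^-1` _ = \bigcup_(j in [set j | Y (f (z j))]) [set z j]
      `|` (if -oo \in Y then ~` range z else set0)).
    apply: measurableU.
      by apply: fin_bigcup_measurable => // j _; exact: m1.
    by case: ifP => // _; exact: measurableC.
  apply/seteqP; split => x /=.
    rewrite /F; case: ifPn.
      by rewrite inE => -[j _ <-] Yj; left; exists j.
    rewrite notin_setE => xz Yx; right.
    by rewrite ifT// inE.
  case.
    by move=> [j /= Yj ->]; rewrite Fz.
  case: ifPn; rewrite ?inE// => YN xz; rewrite /F ifN// notin_setE//.
apply: le_trans
  (le_integral_nonmeasurable uniform_at (_ : forall x, F x <= f x)).
  have FE j : F (z j) = F^\+ (z j) - F^\- (z j).
    by rewrite [in LHS](funeposneg F).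
  rewrite integralE !ge0_integral_uniform_at//; last 2 first.
  - exact: measurable_funeneg.
  - exact: measurable_funepos.
  (* Since [f] avoids -oo at the atoms, the negative part is finite there and the two sums can be
     subtracted termwise. *)
  have finneg j : F^\- (z j) \is a fin_num.
    rewrite funenegE Fz; move: (fz j); case: (f (z j)) => [r _|_|//].
      by rewrite -EFinN -EFin_max.
    by rewrite max_r //= leNye.
  rewrite -muleBr//; last first.
    by rewrite fin_num_adde_defl// fin_numN; apply/sum_fin_numP.
  rewrite lee_pmul2l// ?lte_fin ?invr_gt0//.
  rewrite -sumeN; last by move=> i j _ _; rewrite fin_num_adde_defl.
  by rewrite -big_split /=; apply: lee_sum => j _; rewrite -Fz FE.
by move=> x; rewrite /F; case: ifP => // _; rewrite leNye.
Qed.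

End uniform_measure.

(** * The Wasserstein ball of order infinity around an empirical distribution *)

Section wasserstein_ball.
Context d (T : measurableType d) (R : realType) (dist : T -> T -> R) (n : nat).
Hypothesis mdist : measurable_fun [set: T * T] (fun z => dist z.1 z.2).
Hypothesis dist_refl : forall a, dist a a = 0.
Hypothesis dist_triangle : forall a b c, dist a c <= dist a b + dist b c.
Variable zeta : 'I_n.+1 -> T.

Lemma measurable_distl b : measurable_fun [set: T] (dist^~ b).
Proof.
rewrite (_ : dist^~ b = (fun z => dist z.1 z.2) \o (fun a => (a, b)))//.
by apply: measurableT_comp => //; exact: measurable_fun_pair.
Qed.

(** The uniform distribution on the pairs [(xi j, zeta j)] is a coupling, and all its atoms have
    distance at most [theta]. *)
Lemma wasserstein_oo_uniform_at_le (xi : 'I_n.+1 -> T) (theta : R) :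
  (forall j, dist (xi j) (zeta j) <= theta) ->
  (wasserstein_oo dist (uniform_at R xi) (empirical R zeta) <= theta%:E)%E.
Proof.
move=> xiz; apply: ge_ereal_inf.
pose Q : probability (T * T)%type R := uniform_at R (fun j => (xi j, zeta j)).
exists (ess_sup Q (fun z => (dist z.1 z.2)%:E)).
  exists Q => // A mA; split; rewrite /pushforward /Q /= uniform_atE /empirical.
    by rewrite uniform_atE.
  by [].
apply/ess_supP/ae_le_measureP; first exact/measurable_EFinP.
rewrite /Q /= uniform_atE /empirical big1 ?mule0// => j _.
rewrite diracE memNset//= in_itv /= andbT lte_fin.
by apply/negP; rewrite -leNgt.
Qed.

Section upper_bound.
Variables (theta : R) (v : 'I_n.+1 -> R).
(** A shift that puts every [v j + c] between 0 and [c + c], so that nonnegative integration applies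
    and [c + c] serves as a neutral value for the minimum. *)
Let c : R := \sum_j `|v j|.

Let v_le j : v j + c <= c + c.
Proof.
by rewrite lerD2r (le_trans (ler_norm _))// /c (bigD1 j)//= lerDl sumr_ge0.
Qed.

Let v_ge j : 0 <= v j + c.
Proof.
rewrite -lerBlDr sub0r; apply: le_trans (_ : - `|v j| <= _).
  by rewrite lerN2 /c (bigD1 j)//= lerDl sumr_ge0.
by rewrite lerNl ler_normr lexx orbT.
Qed.

Let c_ge : 0 <= c + c. Proof. by rewrite addr_ge0 ?sumr_ge0. Qed.

(* With t = theta this is a majorant of the (shifted) recourse function;
   with t = 0 its value at zeta j is at most v j + c. *)
Let psi (t : R) (a : T) : R :=
  \big[Num.min/c + c]_(j < n.+1)
    (if dist a (zeta j) <= t then v j + c else c + c).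

Let psi_ge0 t a : 0 <= psi t a.
Proof. by apply: le_bigmin => // j _; case: ifP. Qed.

Let psi_lec t a : psi t a <= c + c.
Proof. exact: bigmin_le_id. Qed.

Let psi_lev t a j : dist a (zeta j) <= t -> psi t a <= v j + c.
Proof. by move=> h; apply: (bigmin_inf j) => //; rewrite h. Qed.

Let measurable_psi t : measurable_fun [set: T] (psi t).
Proof.
rewrite /psi; elim: (index_enum _) => [|j s ih].
  by under eq_fun do rewrite big_nil; exact: measurable_cst.
under eq_fun do rewrite big_cons; apply: measurable_minr => //.
apply: measurable_fun_ifT => //.
by apply: measurable_fun_ler => //; exact: measurable_distl.
Qed.

(** Outside the shell, being within [theta + e] of a data point already means being within [theta]
    of it. *)
Let Shell (e : R) : set T :=
  \bigcup_(j in [set: 'I_n.+1]) (dist^~ (zeta j) @^-1` `]theta, theta + e]).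
Let Far (t : R) : set T :=
  ~` \bigcup_(j in [set: 'I_n.+1]) (dist^~ (zeta j) @^-1` `]-oo, t]).

Let measurable_Shell e : measurable (Shell e).
Proof.
apply: fin_bigcup_measurable => // j _.
by rewrite -[_ @^-1` _]setTI; apply: measurable_distl.
Qed.

Let measurable_Far t : measurable (Far t).
Proof.
apply: measurableC; apply: fin_bigcup_measurable => // j _.
by rewrite -[_ @^-1` _]setTI; apply: measurable_distl.
Qed.

Let Far_sub e : Far theta `<=` Shell e `|` Far (theta + e).
Proof.
move=> a Fa; have [Ba|Ba] := pselect (Shell e a); [by left|right].
move=> [j _ /=]; rewrite in_itv /= => jle.
have [jt|jt] := leP (dist a (zeta j)) theta.
  by apply: Fa; exists j; rewrite //= in_itv.
by apply: Ba; exists j; rewrite //= in_itv /= jt.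
Qed.

(** If [v j + c] enters the minimum at [b], then [dist b (zeta j) <= 0]; the triangle inequality
    puts [a] within [theta + e] of [zeta j], hence within [theta], and the same value enters at
    [a]. *)
Let psi_transport (e : R) (a b : T) : dist a b <= theta + e -> ~ Shell e a ->
  psi theta a <= psi 0 b.
Proof.
move=> ab nB; apply: le_bigmin => // j _; case: ifPn => // bj.
apply: psi_lev; rewrite leNgt; apply/negP => aj; apply: nB; exists j => //=.
rewrite in_itv /= aj /= (le_trans (dist_triangle a b _))//.
by rewrite -[leRHS]addr0 lerD.
Qed.

Variable P : probability T R.
Hypothesis Pball :
  (wasserstein_oo dist P (empirical R zeta) <= theta%:E)%E.
Local Open Scope ereal_scope.

Let avg : \bar R := (n.+1%:R^-1)%:E * \sum_(j < n.+1) (v j + c)%:E.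

Let almost_coupling (e : R) : (0 < e)%R ->
  exists2 Q, coupling P (empirical R zeta) Q &
    {ae Q, forall z, (dist z.1 z.2 <= theta + e)%R}.
Proof.
move=> e0; have /ereal_inf_lt : wasserstein_oo dist P (empirical R zeta) <
    (theta + e)%:E by rewrite (le_lt_trans Pball)// lte_fin ltrDl.
move=> [_ [Q QPz <-] /ltW /ess_supP Qle].
by exists Q => //; apply: filterS Qle => z; rewrite lee_fin.
Qed.

(** Under the coupling, a first component in [Far (theta + e)] almost surely forces the second into
    [Far 0], which contains no data point. So [Far (theta + e)] is [P]-null and only the shell
    remains. *)
Let P_Far e : (0 < e)%R -> P (Far theta) <= P (Shell e).
Proof.
move=> e0; have [Q Qc [A [mA QA0 subA]]] := almost_coupling e0.
have PFar0 : P (Far (theta + e)) = 0.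
  have [<- _] := Qc _ (measurable_Far (theta + e)).
  have [_ Qz0] := Qc _ (measurable_Far 0).
  have mF : measurable (fst @^-1` Far (theta + e) : set (T * T)).
    by rewrite -[_ @^-1` _]setTI; apply: measurable_fst.
  have mS : measurable (snd @^-1` Far 0 : set (T * T)).
    by rewrite -[_ @^-1` _]setTI; apply: measurable_snd.
  apply: (@subset_measure0 _ _ _ Q _ (A `|` snd @^-1` _) mF _ _ _) => //.
  - exact: measurableU mA mS.
  - move=> z /= Fz; have [zle|] :=
      pselect (dist z.1 z.2 <= theta + e)%R; last first.
      by move=> nz; left; apply: subA.
    right=> -[j _ /=]; rewrite in_itv /= => z2j; apply: Fz; exists j => //=.
    rewrite in_itv /= (le_trans (dist_triangle _ z.2 _))//.
    by rewrite -[leRHS]addr0 lerD.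
  - apply: (@null_set_setU _ _ _ Q) => //.
    rewrite [LHS]Qz0 /empirical big1 ?mule0// => j _.
    rewrite diracE memNset//= => nj; apply: nj; exists j => //=.
    by rewrite in_itv /= dist_refl.
apply: (@le_trans _ _ (P (Shell e `|` Far (theta + e)))).
  by apply: le_measure; rewrite ?inE//; exact: measurableU.
by apply: (le_trans (measureU2 _ _ _)) => //; rewrite [X in _ + X]PFar0 adde0.
Qed.

(** Along the coupling, [psi theta] at the first component is at most [psi 0] at the second, except
    on the shell, where the crude bound [c + c] is paid. The second marginal then sees only the data
    points. *)
Let P_psi e : (0 < e)%R ->
  \int[P]_a (psi theta a)%:E <= avg + (c + c)%:E * P (Shell e).
Proof.
move=> e0; have [Q Qc Qe] := almost_coupling e0.
have mpsi t : measurable_fun [set: T] (EFin \o psi t) by exact/measurable_EFinP.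
have -> : \int[P]_a (psi theta a)%:E = \int[Q]_z (psi theta z.1)%:E.
  apply: (@ge0_integral_same_law _ _ _ _ _ Q P fst (EFin \o psi theta)) => //.
  - by move=> A mA; have [] := Qc _ mA.
  - by move=> a /=; rewrite lee_fin.
have -> : avg + (c + c)%:E * P (Shell e) = avg + (c + c)%:E * Q (fst @^-1` Shell e).
  by have [<- _] := Qc _ (measurable_Shell e).
have mB : measurable (fst @^-1` Shell e : set (T * T)).
  by rewrite -[_ @^-1` _]setTI; apply: measurable_fst.
apply: (@le_trans _ _ (\int[Q]_z ((psi 0 z.2)%:E +
    (c + c)%:E * (\1_(fst @^-1` Shell e) z)%:E))).
  apply: ae_ge0_le_integral => //.
  - by move=> z _; rewrite lee_fin.
  - exact: measurableT_comp (mpsi _) measurable_fst.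
  - by move=> z _; rewrite adde_ge0 ?lee_fin// mulr_ge0.
  - apply: emeasurable_funD.
      exact: measurableT_comp (mpsi _) measurable_snd.
    by apply: measurable_funeM; exact/measurable_EFinP/measurable_indic.
  - apply: filterS Qe => z zle _; rewrite -EFinM -EFinD lee_fin indicE.
    have [/set_mem|/negP zB] := boolP (z \in _).
      by move=> _; rewrite mulr1 (le_trans (psi_lec _ _))// lerDr.
    rewrite mulr0 addr0 (psi_transport zle)// => Bz; apply: zB.
    by rewrite inE.
rewrite ge0_integralD//; last 4 first.
- by move=> z _; rewrite lee_fin.
- exact: measurableT_comp (mpsi _) measurable_snd.
- by move=> z _; rewrite lee_fin mulr_ge0.
- by apply: measurable_funeM; exact/measurable_EFinP/measurable_indic.
apply: leeD.
  have <- : \int[uniform_at R zeta]_b (psi 0 b)%:E = \int[Q]_z (psi 0 z.2)%:E.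
    apply: (@ge0_integral_same_law _ _ _ _ _ Q _ snd (EFin \o psi 0)) => //.
      by move=> A mA; have [_ ->] := Qc _ mA; rewrite -uniform_atE.
    by move=> a /=; rewrite lee_fin.
  rewrite (ge0_integral_uniform_at zeta (mpsi _))//; last first.
    by move=> a /=; rewrite lee_fin.
  rewrite lee_pmul2l// ?lte_fin ?invr_gt0//.
  by apply: lee_sum => j _; rewrite lee_fin psi_lev// dist_refl.
rewrite ge0_integralZl//; last by exact/measurable_EFinP/measurable_indic.
by rewrite integral_indic// setIT.
Qed.

(** The shells of width 1/(k+1) decrease to the empty set, so continuity from above removes the
    error term. *)
Let le_of_Shell (x y K : R) : (0 <= K)%R ->
  (forall e, (0 < e)%R -> x%:E <= y%:E + K%:E * P (Shell e)) -> (x <= y)%R.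
Proof.
move=> K0 xy; pose B k := Shell k.+1%:R^-1.
have Bcap : \bigcap_k B k = set0.
  apply/seteqP; split => // a Ba.
  (* The least excess over [theta] among the data points farther than [theta] from [a]; the default
     1 keeps it positive if there are none. *)
  pose gap := \big[Num.min/1%R]_(j | (theta < dist a (zeta j))%R)
    (dist a (zeta j) - theta)%R.
  have : (0 < gap)%R by apply: lt_bigmin => // j; rewrite subr_gt0.
  move=> /ltr_add_invr[k]; rewrite add0r => kgap.
  have [j _ /=] := Ba k I; rewrite in_itv /= => /andP[aj].
  rewrite leNgt -ltrBrDl => /negP; apply; apply: (lt_le_trans kgap).
  exact: bigmin_le_cond.
have : P \o B @ \oo --> P (\bigcap_k B k).
  apply: nonincreasing_cvg_mu => //.
  - exact: le_lt_trans (probability_le1 P (measurable_Shell _)) (ltry 1%R).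
  - by move=> k; exact: measurable_Shell.
  - by rewrite Bcap.
  - move=> k m km; apply/subsetPset => a [j _ /=]; rewrite !in_itv /=.
    move=> /andP[aj aj']; exists j => //=.
    rewrite in_itv /= aj (le_trans aj')//.
    by rewrite lerD2l lef_pV2 ?posrE// ler_nat.
rewrite Bcap measure0 => PB.
have cv : (fun k => y%:E + K%:E * (P \o B) k) @ \oo --> y%:E + K%:E * 0.
  apply: cvgeD => //; first exact: cvg_cst.
  exact: cvgeZl.
rewrite -lee_fin -[leRHS]adde0 -[in leRHS](mule0 K%:E); apply: cvge_ge cv.
by apply: nearW => k; apply: xy; rewrite invr_gt0.
Qed.

Let P_Far0 : P (Far theta) = 0.
Proof.
apply/eqP; rewrite eq_le measure_ge0 andbT.
rewrite -[leLHS](@fineK R) ?fin_num_measure// lee_fin.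
apply: (@le_of_Shell _ _ 1) => // e e0.
by rewrite add0e mul1e fineK ?fin_num_measure// P_Far.
Qed.

Let bounded_psi : P.-integrable [set: T] (EFin \o psi theta).
Proof.
apply: measurable_bounded_integrable => //.
  exact: le_lt_trans (probability_le1 P measurableT) (ltry 1%R).
exists (c + c)%R; split; first exact: num_real.
move=> M cM a _ /=; rewrite ger0_norm// (le_trans (psi_lec _ _))//.
exact: ltW.
Qed.

Lemma integral_wasserstein_ball_le (D : set T) (g : T -> \bar R) :
  measurable D -> P D = 1 ->
  (forall j a, D a -> (dist a (zeta j) <= theta)%R -> g a <= (v j)%:E) ->
  \int[P]_(a in D) g a <= (n.+1%:R^-1)%:E * \sum_(j < n.+1) (v j)%:E.
Proof.
move=> mD PD gv; rewrite integral_mkcond.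
pose S := D `\` Far theta.
have mS : measurable S by exact: measurableD.
have SC0 : P (~` S) = 0.
  have PDC : P (~` D) = 0 by rewrite probability_setC// PD subee.
  by rewrite setCD null_set_setU//; exact: measurableC.
pose G a := if a \in S then (psi theta a - c)%:E else +oo.
have mpsic : measurable_fun [set: T] (fun a => (psi theta a - c)%:E).
  by apply/measurable_EFinP/measurable_funB.
have mG : measurable_fun [set: T] G.
  apply: measurable_fun_ifT => //; apply: (measurable_fun_bool true).
  rewrite setTI (_ : _ @^-1` _ = S)//.
  by apply/seteqP; split => a /=; [exact: set_mem | exact: mem_set].
apply: (@le_trans _ _ (\int[P]_a G a)).
  apply: le_integral_nonmeasurable => a; rewrite /G.
  have [/set_mem [Da nFa]|_] := boolP (a \in S); last exact: leey.
  rewrite patchE mem_set//.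
  (* Some ball contains [a], so [g a] is at most a real [v j]. This bounds it by the default [c + c]
     after the shift, and each ball containing [a] supplies its own bound. *)
  have /contrapT[j _] := nFa; rewrite /= in_itv /= => aj.
  have gj := gv j a Da aj; case ga : (g a) gj => [r| |]// rj.
    rewrite lee_fin lerBrDr; apply: le_bigmin => [|i _].
      by rewrite (le_trans _ (v_le j))// lerD2r -lee_fin.
    case: ifPn => ai.
      by rewrite lerD2r -lee_fin -ga gv.
    by rewrite (le_trans _ (v_le j))// lerD2r -lee_fin.
  exact: leNye.
rewrite (ae_eq_integral (fun a => (psi theta a)%:E - c%:E))//; last first.
  exists (~` S); split => // [|a]; first exact: measurableC.
  by apply: contra_not => aS _; rewrite /G mem_set// EFinB.
rewrite integralB_EFin//; last first.
  apply: measurable_bounded_integrable => //.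
    exact: le_lt_trans (probability_le1 P measurableT) (ltry 1%R).
  exact: bounded_cst.
rewrite integral_cst// [X in _ * X](probability_setT P) mule1.
rewrite sumEFin -EFinM -[X in X - _](@fineK R); last first.
  exact: integrable_fin_num bounded_psi.
rewrite -EFinB lee_fin lerBlDr; apply: (@le_of_Shell _ _ (c + c)%R) => // e e0.
rewrite fineK; last exact: integrable_fin_num bounded_psi.
apply: le_trans (P_psi e0) _; rewrite leeD2r// /avg sumEFin -EFinM lee_fin.
rewrite big_split /= mulrDr sumr_const card_ord.
rewrite -[(c *+ _)%R]mulr_natl mulrA mulVf ?mul1r//.
Qed.

End upper_bound.

End wasserstein_ball.

(** * Linear programs with a parametric right-hand side *)

Section lin_min_theory.
Context (R : realType) (n m l : nat).
Variables (b : 'cV[R]_n) (M : 'M[R]_(l, m)) (W : 'M[R]_(l, n)) (h : 'cV[R]_l).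
Let g (u : 'cV[R]_m) := lin_min b [set y | cv_ge (M *m u + W *m y) h].
Let obj (y : 'cV[R]_n) : R := (b^T *m y) 0 0.

(** Weak duality: the dual objective at [pi] is a finite lower bound. *)
Lemma lin_min_neq_Noo (pi : 'cV[R]_l) (u : 'cV[R]_m) :
  cv_ge pi 0 -> W^T *m pi = b -> g u != -oo%E.
Proof.
move=> pi0 defb; rewrite gt_eqF//.
apply: (@lt_le_trans _ _ ((pi^T *m (h - M *m u)) 0 0)%:E); first exact: ltNyr.
apply: le_ereal_inf_tmp => _ [y /= Fy <-].
rewrite lee_fin -defb trmx_mul trmxK -mulmxA.
rewrite !mxE; apply: ler_sum => i _; rewrite ler_wpM2l//.
  by have := pi0 i; rewrite !mxE.
by have := Fy i; rewrite !mxE lerBlDl.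
Qed.

(** The same convex combination of nearly optimal solutions is feasible for the combined parameter.
    The slack [e] covers infima that are not attained. *)
Lemma lin_min_convex (I : finType) (w : I -> R) (u : I -> 'cV[R]_m) (K : R) :
  (forall k, 0 <= w k) -> \sum_k w k = 1 -> (forall k, (g (u k) <= K%:E)%E) ->
  (g (\sum_k w k *: u k) <= K%:E)%E.
Proof.
move=> w0 w1 gK; apply/lee_addgt0Pr => e e0.
have y_ k : {y | cv_ge (M *m u k + W *m y) h /\ obj y <= K + e}.
  apply: cid; have : (g (u k) < (K + e)%:E)%E.
    by rewrite (le_lt_trans (gK k))// lte_fin ltrDl.
  move=> /ereal_inf_lt[_ [y Fy <-]]; rewrite lte_fin => /ltW yK.
  by exists y.
pose y := \sum_k w k *: sval (y_ k).
apply: ge_ereal_inf; exists (obj y)%:E.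
  exists y => //= i; rewrite !mulmx_sumr -big_split /= summxE.
  rewrite -[leLHS]mul1r -w1 mulr_suml; apply: ler_sum => k _.
  rewrite -!scalemxAr -scalerDr mxE ler_wpM2l//.
  by have [+ _] := svalP (y_ k); exact.
rewrite -EFinD lee_fin /obj mulmx_sumr summxE.
rewrite -[leRHS]mul1r -w1 mulr_suml; apply: ler_sum => k _.
by rewrite -scalemxAr mxE ler_wpM2l//; have [] := svalP (y_ k).
Qed.

Lemma l1_ball_vertices (theta : R) (d : 'cV[R]_m) : (0 < m)%N -> 0 < theta ->
  \sum_i `|d i 0| <= theta ->
  exists w : bool * 'I_m -> R, [/\ forall k, 0 <= w k, \sum_k w k = 1 &
    d = \sum_k w k *: ((theta * (-1) ^+ k.1) *: delta_mx k.2 0)].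
Proof.
move=> m0 th0 dth.
have mR : m%:R != 0 :> R by rewrite pnatr_eq0 -lt0n.
pose s : R := (theta - \sum_i `|d i 0|) / m%:R.
have s0 : 0 <= s by rewrite divr_ge0 ?subr_ge0.
pose a (i : 'I_m) : R := `|d i 0|.
pose w (c : bool) (i : 'I_m) : R := (a i + (-1) ^+ c * d i 0 + s) / 2 / theta.
exists (fun k => w k.1 k.2); split.
- move=> [c i] /=; rewrite !divr_ge0 ?(ltW th0)// addr_ge0// /a.
  case: c; rewrite ?expr1 ?mulN1r ?expr0 ?mul1r ?subr_ge0 ?ler_norm//.
  by rewrite -lerBlDr sub0r -normrN ler_norm.
- rewrite -(pair_big xpredT xpredT w)/= big_bool /= -big_split /=.
  under eq_bigr => i _.
    rewrite (_ : _ + _ = (a i + s) / theta); last first.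
      by rewrite /w /=; field; rewrite gt_eqF.
    over.
  rewrite -mulr_suml big_split /= sumr_const card_ord.
  by rewrite -[s *+ _]mulr_natl /s mulrCA divff// mulr1 subrKC divff// gt_eqF.
- apply/colP => i; rewrite summxE.
  rewrite -(pair_big xpredT xpredT (fun (c : bool) k =>
    (w c k *: ((theta * (-1) ^+ c) *: delta_mx k 0) : 'cV_m) i 0))/=.
  rewrite big_bool /= -big_split /= (bigD1 i)//= big1 ?addr0.
    by rewrite !mxE !eqxx /w /=; field; rewrite gt_eqF.
  by move=> k ki; rewrite !mxE eq_sym (negbTE ki) /= !mulr0 addr0.
Qed.

Lemma lin_min_l1_ball (theta : R) (u u0 : 'cV[R]_m) (K : R) :
  (0 < m)%N -> \sum_i `|u i 0 - u0 i 0| <= theta ->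
  (forall (c : bool) i,
    (g (u0 - (theta * (-1) ^+ c) *: delta_mx i 0)%R <= K%:E)%E) ->
  (g u <= K%:E)%E.
Proof.
move=> m0 uth gK.
(* The vertex weights divide by [theta], so the degenerate ball is treated apart. *)
have [th0|th0] := leP theta 0.
  have uu0 : u = u0.
    apply/colP => i; apply/eqP; rewrite -subr_eq0 -normr_le0.
    rewrite (le_trans _ (le_trans uth th0))// (bigD1 i)//= lerDl sumr_ge0//.
  have t0 : theta = 0.
    by apply/eqP; rewrite eq_le th0 (le_trans _ uth)// sumr_ge0.
  by have := gK true (Ordinal m0); rewrite t0 mul0r scale0r subr0 uu0.
(* The vertices are subtracted from [u0], hence [u0 - u] is decomposed. *)
have [|w [w0 w1 dw]] := @l1_ball_vertices theta (u0 - u) m0 th0.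
  by rewrite (le_trans _ uth)// ler_sum// => i _; rewrite !mxE distrC.
have -> : u = \sum_k w k *: (u0 - (theta * (-1) ^+ k.1) *: delta_mx k.2 0).
  under eq_bigr do rewrite scalerBr.
  by rewrite sumrB -dw -scaler_suml w1 scale1r opprB addrC subrK.
by apply: lin_min_convex.
Qed.

End lin_min_theory.

(** * The l1 distance and Borel measurability *)

Section l1_distance.
Context (R : realType) (m1 m2 : nat).
Local Notation U := (uncertainty R m1 m2).

Lemma lp_dist1E (a b : U) : lp_dist 1%:E a b =
  \sum_i `|a.1 i 0 - b.1 i 0| + \sum_i `|a.2 i 0 - b.2 i 0|.
Proof.
rewrite /lp_dist /lp_norm invr1 powRr1; last first.
  by apply: sumr_ge0 => i _; exact: powR_ge0.
under eq_bigr do rewrite powRr1//.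
rewrite big_split_ord /=; congr (_ + _); apply: eq_bigr => i _.
  by rewrite col_mxEu !mxE.
by rewrite col_mxEd !mxE.
Qed.

Lemma continuous_measurable_uncertainty (f : 'cV[R]_m1 * 'cV[R]_m2 -> R) :
  continuous f -> measurable_fun [set: U] (f : U -> R).
Proof.
move=> cf; apply: (@measurability _ _ _ _ _ _ (@RGenOpens.G R)).
  exact: RGenOpens.measurableE.
move=> _ [_ [a [b ->]] <-]; rewrite setTI; apply: sub_sigma_algebra.
by move/continuousP : cf; apply; exact: itv_open.
Qed.

Lemma measurable_coord1 i : measurable_fun [set: U] (fun a : U => a.1 i 0).
Proof.
apply: (@continuous_measurable_uncertainty (fun a => a.1 i 0)) => a.
apply: (@continuous_comp _ _ _ fst (fun v : 'cV[R]_m1 => v i 0)).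
  exact: cvg_fst.
exact: coord_continuous.
Qed.

Lemma measurable_coord2 i : measurable_fun [set: U] (fun a : U => a.2 i 0).
Proof.
apply: (@continuous_measurable_uncertainty (fun a => a.2 i 0)) => a.
apply: (@continuous_comp _ _ _ snd (fun v : 'cV[R]_m2 => v i 0)).
  exact: cvg_snd.
exact: coord_continuous.
Qed.

(** The sigma-algebra on [U * U] is the product of two Borel ones, so the distance is assembled from
    the measurable coordinates of each factor. *)
Lemma measurable_lp_dist1 :
  measurable_fun [set: U * U] (fun z => lp_dist 1%:E z.1 z.2).
Proof.
under eq_fun do rewrite lp_dist1E.
apply: measurable_funD; apply: measurable_sum => i;
  apply: measurableT_comp => //; apply: measurable_funB.
- exact: (measurableT_comp (measurable_coord1 i) measurable_fst).
- exact: (measurableT_comp (measurable_coord1 i) measurable_snd).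
- exact: (measurableT_comp (measurable_coord2 i) measurable_fst).
- exact: (measurableT_comp (measurable_coord2 i) measurable_snd).
Qed.

Lemma lp_dist1_refl (a : U) : lp_dist 1%:E a a = 0.
Proof. by rewrite lp_dist1E !big1 ?addr0// => i _; rewrite subrr normr0. Qed.

Lemma lp_dist1_triangle (a b c : U) :
  lp_dist 1%:E a c <= lp_dist 1%:E a b + lp_dist 1%:E b c.
Proof.
rewrite !lp_dist1E addrACA; apply: lerD; rewrite -big_split /=;
  by apply: ler_sum => i _; exact: ler_distD.
Qed.

Lemma measurable_fst_eq (u : 'cV[R]_m1) :
  measurable ([set u] `*` [set: 'cV[R]_m2] : set U).
Proof.
rewrite (_ : _ `*` _ = \bigcap_(i in [set: 'I_m1])
    ((fun a : U => a.1 i 0) @^-1` [set u i 0])).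
  apply: fin_bigcap_measurable => // i _; rewrite -[_ @^-1` _]setTI.
  exact: measurable_coord1.
apply/seteqP; split => [a [/= a1 _] i _ /=|a au]; first by rewrite a1.
by split => //=; apply/colP => i; exact: au.
Qed.

Lemma measurable_uncertainty_set1 (a : U) : measurable [set a].
Proof.
rewrite (_ : [set a] = ([set a.1] `*` [set: 'cV[R]_m2]) `&`
    \bigcap_(i in [set: 'I_m2])
    ((fun b : U => b.2 i 0) @^-1` [set a.2 i 0])).
  apply: measurableI; first exact: measurable_fst_eq.
  apply: fin_bigcap_measurable => // i _; rewrite -[_ @^-1` _]setTI.
  exact: measurable_coord2.
apply/seteqP; split => [b ->//|[b1 b2] [[/= b1E _] b2E]].
rewrite /= [RHS]surjective_pairing -b1E.
by congr pair; apply/colP => i; exact: b2E.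
Qed.

End l1_distance.

(** * Maxima over signs, coded as (-1)^c, and coordinates *)

Lemma exists_bigmaxe_ge (R : realType) m (F : R -> 'I_m -> \bar R) :
  (0 < m)%N -> exists (c : bool) i,
  (\big[maxe/-oo]_(r <- [:: (-1)%R; 1%R]) \big[maxe/-oo]_(i < m) F r i
    <= F ((-1) ^+ c)%R i)%E.
Proof.
move=> m0; pose V r := (\big[maxe/-oo]_(i < m) F r i)%E.
have VF r : exists i, (V r <= F r i)%E.
  have [//|i _|i _ Vi] := @eq_bigmax _ _ _ -oo%E (Ordinal m0) xpredT (F r).
    exact: leNye.
  by exists i; rewrite /V Vi.
rewrite !big_cons big_nil -!/(V _).
have [le1|/ltW le1] := leP (V (-1)) (V 1).
  have [i Vi] := VF 1; exists false, i.
  by rewrite expr0 ge_max (le_trans le1)//= ge_max Vi leNye.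
have [i Vi] := VF (-1); exists true, i.
by rewrite expr1 ge_max Vi ge_max (le_trans le1)//= leNye.
Qed.

Lemma le_bigmaxe_pm1 (R : realType) m (F : R -> 'I_m -> \bar R) (c : bool) i :
  (F ((-1) ^+ c)%R i <=
   \big[maxe/-oo]_(r <- [:: (-1)%R; 1%R]) \big[maxe/-oo]_(i < m) F r i)%E.
Proof.
rewrite !big_cons big_nil !le_max; apply/orP.
by case: c; [left|right; apply/orP; left]; rewrite ?expr1 ?expr0;
  exact: (le_bigmax _ (F _) i).
Qed.

(** * Assembling the upper and lower bounds *)

Theorem theorem3 (R : realType) (n1 n2 m1 m2 l N : nat)
    (hn1 : (0 < n1)%N) (hn2 : (0 < n2)%N) (hm1 : (0 < m1)%N)
    (hm2 : (0 < m2)%N) (hl : (0 < l)%N) (hN : (0 < N)%N)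
    (X : set 'cV[R]_n1)
    (W : 'M[R]_(l, n2)) (Q : 'M[R]_(n2, m1)) (q : 'cV[R]_n2)
    (h : 'cV[R]_n1 -> 'cV[R]_l) (T : 'cV[R]_n1 -> 'M[R]_(l, m2))
    (haff : affine_map h) (Taff : affine_map T)
    (xiq : 'cV[R]_m1) (Xi : set (uncertainty R m1 m2))
    (hXi : Xi = [set xiq] `*` [set: 'cV[R]_m2])
    (p : \bar R) (hp : p = 1%:E)
    (theta : R) (htheta : 0 <= theta)
    (zeta : 'I_N -> uncertainty R m1 m2) (hzeta : forall j, Xi (zeta j))
    (hdual : sufficiently_expensive W Q q X Xi)
    (x : 'cV[R]_n1) (hx : X x) :
  worst_case W Q q h T p theta Xi zeta x =
  ((N%:R^-1)%:E *
   \sum_(j < N)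
     \big[maxe/-oo]_(r <- [:: -1; 1]%R)
       \big[maxe/-oo]_(i < m2)
         (lin_min (Q *m xiq + q)
           [set y | cv_ge (T x *m (zeta j).2 + W *m y
                           - (theta * r) *: (T x *m delta_mx i 0))
                          (h x)])%R)%E.
Proof.
case: N hN zeta hzeta => // n _ zeta hzeta.
move: hzeta hdual; rewrite {}hp {}hXi => hzeta hdual.
pose g (u : 'cV[R]_m2) :=
  lin_min (Q *m xiq + q) [set y | cv_ge (T x *m u + W *m y) (h x)].
have gNoo u : g u != -oo%E.
  have [|pi [pi0 piE]] := hdual x (xiq, u) hx; first by [].
  exact: lin_min_neq_Noo pi0 piE.
(* By linearity, the extra constraint term is a move of the data point to a vertex of its l1
   ball. *)
have shiftE j r i : lin_min (Q *m xiq + q)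
    [set y | cv_ge (T x *m (zeta j).2 + W *m y
      - (theta * r) *: (T x *m delta_mx i 0)) (h x)] =
    g ((zeta j).2 - (theta * r) *: delta_mx i 0).
  rewrite /g; congr lin_min; apply/seteqP; split => y /=;
  by rewrite mulmxBr -scalemxAr addrAC.
under eq_bigr do under eq_bigr do under eq_bigr do rewrite shiftE.
pose F j (r : R) i := g ((zeta j).2 - (theta * r) *: delta_mx i 0).
pose V j := (\big[maxe/-oo]_(r <- [:: (-1)%R; 1%R])
  \big[maxe/-oo]_(i < m2) F j r i)%E.
have mXi := @measurable_fst_eq R m1 m2 xiq.
rewrite -[RHS]/((n.+1%:R^-1)%:E * \sum_(j < n.+1) V j)%E.
apply/eqP; rewrite eq_le; apply/andP; split.
  (* Upper bound. Dual feasibility excludes -oo, so an infinite [V j] makes the right-hand side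
     +oo. *)
  have [Vfin|] := pselect (forall j, V j \is a fin_num); last first.
    move=> /existsNP[j Vj].
    have VNoo k : V k != -oo%E.
      rewrite gt_eqF//.
      apply: lt_le_trans (le_bigmaxe_pm1 (F k) true (Ordinal hm2)).
      by rewrite ltNye gNoo.
    suff -> : (\sum_(j < n.+1) V j)%E = +oo%E.
      by rewrite gt0_muley ?leey// lte_fin invr_gt0.
    apply/eqP; rewrite esum_eqy//; apply/existsP; exists j => /=.
    by move: Vj (VNoo j); case: (V j).
  apply: ge_ereal_sup => _ [P [PXi Pball] <-].
  pose v j := fine (V j).
  rewrite [X in (_ <= _ * X)%E](eq_bigr (fun j => (v j)%:E)); last first.
    by move=> j _; rewrite /v fineK.
  apply: (integral_wasserstein_ball_le (@measurable_lp_dist1 R m1 m2)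
    (@lp_dist1_refl _ _ _) (@lp_dist1_triangle _ _ _) Pball mXi PXi).
  move=> j a [a1 _]; rewrite lp_dist1E /recourse (a1 : a.1 = xiq) => aj.
  apply: (@lin_min_l1_ball _ _ _ _ _ _ _ _ theta _ (zeta j).2 (v j)) => //.
    by apply: le_trans aj; rewrite lerDr sumr_ge0.
  move=> c i; rewrite /v fineK//; exact: (le_bigmaxe_pm1 (F j)).
have /choice[ci ciV] : forall j, exists ci : bool * 'I_m2,
    (V j <= F j ((-1) ^+ ci.1)%R ci.2)%E.
  by move=> j; have [c [i Vci]] := exists_bigmaxe_ge (F j) hm2; exists (c, i).
(* Lower bound: each data point moves to a best vertex. Keeping [xiq] as first component stays in
   the support. *)
pose xi j : uncertainty R m1 m2 :=
  (xiq, (zeta j).2 - (theta * (-1) ^+ (ci j).1) *: delta_mx (ci j).2 0).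
pose f := recourse W Q q h T x \_ ([set xiq] `*` [set: 'cV[R]_m2]).
have fxi j : f (xi j) = F j ((-1) ^+ (ci j).1) (ci j).2.
  by rewrite /f patchE mem_set.
apply: (@le_trans _ _ (\int[uniform_at R xi]_a f a)%E).
  apply: (@le_trans _ _ ((n.+1%:R^-1)%:E * \sum_(j < n.+1) f (xi j))%E).
    rewrite lee_pmul2l// ?lte_fin ?invr_gt0//.
    by apply: lee_sum => j _; rewrite fxi.
  apply: integral_uniform_at_ge; first exact: measurable_uncertainty_set1.
  by move=> j; rewrite fxi; exact: gNoo.
apply: ereal_sup_ubound; exists (uniform_at R xi); last first.
  by rewrite integral_mkcond.
split.
  rewrite -(probability_setT (uniform_at R xi)) /= !uniform_atE.
  rewrite /empirical; congr (_ * _)%E; apply: eq_bigr => j _.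
  by rewrite !diracE !mem_set.
apply: wasserstein_oo_uniform_at_le; first exact: measurable_lp_dist1.
move=> j; rewrite lp_dist1E /=; have [-> _] := hzeta j.
rewrite big1 ?add0r; last by move=> i _; rewrite subrr normr0.
(* Only the coordinate [(ci j).2] moves, by exactly [theta]. *)
rewrite (bigD1 (ci j).2)//= big1 ?addr0.
  rewrite !mxE !eqxx mulr1 addrAC subrr add0r normrN normrM normrX normrN1.
  by rewrite expr1n mulr1 ger0_norm.
by move=> i ici; rewrite !mxE (negbTE ici) mulr0 subr0 subrr normr0.
Qed.
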